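(* For $n=1,2,3,4,5$ the number of labeled loopless directed graphs on $n$ vertices is $1,\ 4,\ 64,\ 4096,\ 1048576$, respectively, and the maximum attractor periods are $$L(1)=1,\quad L(2)=1,\quad L(3)=1,\quad L(4)=3,\quad L(5)=9.$$
   Context: A Pulse Graph is a finite directed graph $G=(V,E)$ with no self-loops (for distinct $u,v$, each of the edges $(u,v)$, $(v,u)$ may or may not be present, with no multiple edges), together with Boolean states $x_t:V\to\{0,1\}$, $t=0,1,2,\dots$. For $v\in V$ let $N^-(v)=\{u\in V:(u,v)\in E\}$ and $k_t(v)=\sum_{u\in N^-(v)}x_t(u)$. All vertices are updated synchronously by: $x_{t+1}(v)=1$ if $k_t(v)$ is a prime number, and $x_{t+1}(v)=0$ otherwise. An attractor of period $p$ is a periodic sequence (periodic orbit) of this update consisting of $p$ distinct states; a fixed point is an attractor of period $1$. $L(n)$ denotes the maximum attractor period among all labeled directed loopless Pulse Graphs on $n$ vertices. *)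

(* Defs.v *)
From HB Require Import structures.
From mathcomp Require Import all_boot.

Set Implicit Arguments.
Unset Strict Implicit.
Unset Printing Implicit Defensive.

Definition loopless (V : finType) (E : {set V * V}) : bool :=
  [forall v, (v, v) \notin E].

Record digraph (V : finType) : predArgType :=
  Digraph { arcs : {set V * V}; _ : loopless arcs }.

HB.instance Definition _ (V : finType) := [isSub for @arcs V].
HB.instance Definition _ (V : finType) := [Finite of digraph V by <:].

Definition state (V : finType) := {ffun V -> bool}.

Definition in_neighbours (V : finType) (G : digraph V) (v : V) : {set V} :=
  [set u | (u, v) \in arcs G].

Definition active_inputs (V : finType) (G : digraph V) (x : state V) (v : V) :
    nat :=
  \sum_(u in in_neighbours G v) x u.

Definition pulse (V : finType) (G : digraph V) (x : state V) : state V :=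
  [ffun v => prime (active_inputs G x v)].

(* An attractor is listed from one of its states; its period is the length of *)
(* the list. [ucycleb] holds of the empty list, which has to be excluded.     *)
Definition attractor (V : finType) (G : digraph V) (c : seq (state V)) : bool :=
  (c != [::]) && ucycleb (frel (pulse G)) c.

Definition has_attractor_of_period (V : finType) (G : digraph V) (p : nat) :
    bool :=
  [exists c : p.-tuple (state V), attractor G c].

(* The bound on [p] loses nothing: an attractor has at most #|state| states   *)
(* (see [max_period_leP]).                                                    *)
Definition max_period (n : nat) : nat :=
  \max_(G : digraph 'I_n)
    \max_(p < #|state 'I_n|.+1 | has_attractor_of_period G p) p.

Lemma max_period_leP (n m : nat) :
  max_period n <= m <->
  (forall (G : digraph 'I_n) (c : seq (state 'I_n)),
     attractor G c -> size c <= m).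
Proof.
split=> [/bigmax_leqP le_m G c Gc | le_m].
  have [_ /andP[_ Uc]] := andP Gc.
  have le_c : size c < #|state 'I_n|.+1 by rewrite ltnS -(card_uniqP Uc) max_card.
  have /bigmax_leqP/(_ (Ordinal le_c)) := le_m G isT; apply.
  by apply/existsP; exists (in_tuple c).
apply/bigmax_leqP=> G _; apply/bigmax_leqP=> p /existsP[c Gc].
by rewrite -[X in X <= _](size_tuple c) (le_m G).
Qed.

Lemma max_period_attained (n : nat) :
  exists (G : digraph 'I_n) (c : seq (state 'I_n)),
    attractor G c /\ size c = max_period n.
Proof.
have G0P : loopless (set0 : {set 'I_n * 'I_n}) by apply/forallP=> v; rewrite inE.
pose G0 := Digraph G0P.
have G0_1 : attractor G0 [:: [ffun=> false]].
  rewrite /attractor /ucycleb /= !andbT; apply/eqP/ffunP=> v; rewrite !ffunE.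
  by rewrite /active_inputs big1 // => u; rewrite !inE.
have max_gt0 : 0 < max_period n.
  exact: (iffLR (max_period_leP n _) (leqnn _) G0 _ G0_1).
pose F (G : digraph 'I_n) :=
  \max_(p < #|state 'I_n|.+1 | has_attractor_of_period G p) p.
have [G defG] : {G | max_period n = F G}.
  by apply: eq_bigmax; apply/card_gt0P; exists G0.
pose P := [pred p : 'I_#|state 'I_n|.+1 | has_attractor_of_period G p].
have [p Gp defp] : {p | p \in P & F G = p}.
  apply: (@eq_bigmax_cond _ P (@nat_of_ord _)); rewrite lt0n; apply/eqP=> P0.
  by move: max_gt0; rewrite defG /F big_pred0 // => p; apply: (card0_eq P0 p).
have /existsP[c Gc] := Gp.
by exists G, c; rewrite defG defp size_tuple.
Qed.

(* Main.v *)
Require Import Defs.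
From HB Require Import structures.
From mathcomp Require Import all_boot.
From Stdlib Require PeanoNat Lia.

Set Implicit Arguments.
Unset Strict Implicit.
Unset Printing Implicit Defensive.

(** The number of digraphs on [n] vertices is [2 ^ (n * (n - 1))], since such
    a digraph is an arbitrary set of ordered pairs of distinct vertices
    ([card_digraph]).

    The lower bounds on the periods come from explicit orbits. Since inputs of
    level 2 and 3 fire and all others do not, a vertex with two in-neighbours
    is their conjunction, one with three is their majority, and one with four
    tells whether two or three of them are active; a vertex with fewer
    in-neighbours dies after one step. Small circuits of such gates give the
    periods 3 and 9, and the null state has period 1 ([le_max_period]).

    The upper bounds come from an exhaustive search which is cut down by two
    ideas.
    - Listing the vertices by increasing in-degree loses no generality, because
      the search deals with the graph through an arbitrary listing of its
      vertices.
    - A state of an attractor is the image of a state of the same attractor.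
      If the in-neighbourhoods of the first [k] vertices of the listing are
      known, then so are the first [k] entries of each image, and a candidate
      state can be discarded as soon as its first [k] entries are not those of
      the image of another candidate. Discarding goes on until nothing changes;
      when at most [m] candidates remain, no attractor has more than [m] states
      and no graph that extends the current choice has to be examined.
    In the few cases where all in-neighbourhoods have been chosen and more than
    [m] candidates remain, each of these returns to itself within [m] steps.
    The soundness of this search is [short_cycles_sound]. *)

(** * Counting digraphs *)

Lemma card_digraph (V : finType) : #|digraph V| = 2 ^ (#|V| * #|V|.-1).
Proof.
pose diag : {set V * V} := [set (v, v) | v in V].
have looplessE (E : {set V * V}) : loopless E = (E \subset ~: diag).
  apply/forallP/subsetP => [noloop [u v] Euv | sub v].
    rewrite inE; apply/imsetP => -[w _ [uw vw]].
    by move: (noloop w); rewrite -{1}uw -vw Euv.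
  by apply/negP => /sub; rewrite inE => /imsetP[]; exists v.
rewrite card_sub (eq_card (B := powerset (~: diag))) => [|E]; last first.
  by rewrite powersetE -looplessE.
rewrite card_powerset; congr (2 ^ _).
have card_diag : #|diag| = #|V| by apply: card_imset => u v [].
have := cardsC diag; rewrite card_prod card_diag -subn1 mulnBr muln1 => <-.
by rewrite addKn.
Qed.

Lemma card_digraph5 : #|digraph 'I_5| = 1048576.
Proof.
rewrite card_digraph card_ord.
(* Both sides are too large for unary evaluation. The literal is unfolded     *)
(* digit by digit into a Horner expression, which is compared with the power  *)
(* in binary.                                                                 *)
cbn [Nat.of_num_uint Nat.of_uint Nat.of_uint_acc].
rewrite !PeanoNat.Nat.tail_mul_spec (expnM 2 5 5.-1) !expnS !expn0 /muln.
Lia.lia.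
Qed.

(** * The dynamics on bit sequences *)

(** States, and in-neighbourhoods, are coded by their values along a listing of
    the vertices, so that the dynamics can be evaluated. *)
Definition code (V : finType) (s : seq V) (x : state V) : bitseq := map x s.
Definition row (V : finType) (G : digraph V) (s : seq V) (v : V) : bitseq :=
  [seq (u, v) \in arcs G | u <- s].

Definition fires (N x : bitseq) : bool := prime (count id (mask N x)).
Definition step (Ns : seq bitseq) (x : bitseq) : bitseq :=
  [seq fires N x | N <- Ns].

Lemma count_enum (V : finType) (s : seq V) (P : pred V) :
  perm_eq s (enum V) -> count P s = #|P|.
Proof. by move/permP->; rewrite enumT cardE /enum_mem size_filter. Qed.

Lemma code_inj (V : finType) (s : seq V) :
  perm_eq s (enum V) -> injective (code s).
Proof.
move=> /perm_mem s_enum x y /eq_in_map eq_xy; apply/ffunP => v.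
by apply: eq_xy; rewrite s_enum mem_enum.
Qed.

Lemma fires_row (V : finType) (G : digraph V) (s : seq V) x v :
  perm_eq s (enum V) -> fires (row G s v) (code s x) = pulse G x v.
Proof.
move=> s_enum; rewrite /fires /row /code ffunE; congr prime.
rewrite -map_mask -filter_mask count_map count_filter (count_enum _ s_enum).
rewrite -sum1_card /active_inputs big_mkcond [in RHS]big_mkcond.
by apply: eq_bigr => u _; rewrite !inE /=; case: (x u); case: (_ \in _).
Qed.

(** The listing [t] may be a part of [s]: knowing the in-neighbourhoods of some
    vertices gives the next values at these vertices. *)
Lemma step_rows (V : finType) (G : digraph V) (s t : seq V) (x : state V) :
  perm_eq s (enum V) -> step (map (row G s) t) (code s x) = code t (pulse G x).
Proof.
move=> s_enum; rewrite /step -map_comp.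
by apply: eq_map => v; apply: fires_row.
Qed.

(** * Lower bounds from explicit orbits *)

(** [Ns] lists the in-neighbourhoods of the vertices [0, 1, ...] of a digraph,
    each as a bit sequence. *)
Lemma le_max_period n (Ns : seq bitseq) (x : bitseq) p :
    size Ns = n -> all (fun N => size N == n) Ns ->
    all (fun v => ~~ nth false (nth [::] Ns v) v) (iota 0 n) ->
    size x = n ->
    (0 < p) && ucycleb (frel (step Ns)) (traject (step Ns) x p) ->
  p <= max_period n.
Proof.
move=> size_Ns /allP size_N noloop size_x /and3P[p_gt0 cyc_x uniq_x].
have loopless_E :
    loopless [set uv : 'I_n * 'I_n | nth false (nth [::] Ns uv.2) uv.1].
  by apply/forallP => v; rewrite inE (allP noloop) // mem_iota ltn_ord.
pose G := Digraph loopless_E.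
pose s := enum 'I_n.
pose decode y : state 'I_n := [ffun v : 'I_n => nth false y v].
have decodeK y : size y = n -> code s (decode y) = y.
  move=> size_y.
  apply: (@eq_from_nth _ false) => [|i]; rewrite size_map size_enum_ord //.
  move=> lt_in; rewrite (nth_map (Ordinal lt_in)) ?size_enum_ord //.
  by rewrite ffunE nth_enum_ord.
have rowsE : map (row G s) s = Ns.
  apply: (@eq_from_nth _ [::]) => [|i]; rewrite size_map size_enum_ord //.
  move=> lt_in; rewrite (nth_map (Ordinal lt_in)) ?size_enum_ord //.
  have /size_N/eqP size_Ni : nth [::] Ns i \in Ns by rewrite mem_nth ?size_Ns.
  rewrite -[RHS]decodeK //; apply: eq_map => u.
  by rewrite /G inE ffunE /= nth_enum_ord.
have stepE y : step Ns (code s y) = code s (pulse G y).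
  by rewrite -[in LHS]rowsE step_rows.
pose c := traject (pulse G) (decode x) p.
have code_c : map (code s) c = traject (step Ns) x p.
  rewrite /c -[in RHS](decodeK x) //.
  by elim: (p) (decode x) => //= q IHq y; rewrite IHq stepE.
have injs : injective (code s) by apply: code_inj.
have Gc : attractor G c.
  rewrite /attractor /ucycleb -(map_inj_uniq injs) code_c uniq_x andbT.
  apply/andP; split; first by rewrite -size_eq0 size_traject -lt0n.
  rewrite -code_c cycle_map in cyc_x; apply: etrans cyc_x; apply: eq_cycle => y z.
  by rewrite /= stepE (inj_eq injs).
have /max_period_leP/(_ G c Gc) := leqnn (max_period n).
by rewrite size_traject.
Qed.

Lemma max_period_gt0 n : 0 < max_period n.
Proof.
apply: (@le_max_period _ (nseq n (nseq n false)) (nseq n false)).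
- by rewrite size_nseq.
- by apply/allP => N /nseqP[-> _]; rewrite size_nseq.
- apply/allP => v _; rewrite nth_nseq.
  by case: ifP => _; rewrite ?nth_nil // nth_nseq if_same.
- by rewrite size_nseq.
rewrite /ucycleb /= !andbT; apply/eqP.
rewrite /step map_nseq; congr nseq; rewrite /fires.
by elim: (n).
Qed.

Lemma max_period4_ge3 : 3 <= max_period 4.
Proof.
pose Ns : seq bitseq := map (map (leq 1))
  [:: [:: 0; 0; 1; 1]; [:: 1; 0; 0; 1]; [:: 0; 1; 0; 1]; [:: 1; 1; 1; 0]].
exact: (@le_max_period _ Ns [:: false; true; true; true]).
Qed.

Lemma max_period5_ge9 : 9 <= max_period 5.
Proof.
pose Ns : seq bitseq := map (map (leq 1))
  [:: [:: 0; 0; 0; 1; 1]; [:: 1; 0; 0; 1; 1]; [:: 1; 1; 0; 0; 0];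
      [:: 1; 1; 1; 0; 0]; [:: 1; 1; 1; 1; 0]].
exact: (@le_max_period _ Ns [:: false; false; false; true; true]).
Qed.

(** * Upper bounds from an exhaustive search *)

Definition bitseqs (n : nat) : seq bitseq :=
  iter n (fun xs => map (cons false) xs ++ map (cons true) xs) [:: [::]].

Definition restrict (Ns S : seq bitseq) : seq bitseq :=
  let images := map (step Ns) S in [seq x <- S | take (size Ns) x \in images].

Fixpoint prune (fuel : nat) (Ns S : seq bitseq) : seq bitseq :=
  if fuel is fuel'.+1 then
    let T := restrict Ns S in
    if size T < size S then prune fuel' Ns T else S
  else S.

(** The search for an attractor with more than [m] states on [n] vertices. The
    in-neighbourhoods [Ns] of the first vertices have been chosen, [r] vertices
    remain, [d] bounds their in-degrees from below, and [S0] contains the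
    states that may lie on the attractor. Conditionals rather than boolean
    connectives stop the recursion under call-by-value evaluation. *)
Fixpoint short_cycles (n m r d : nat) (Ns S0 : seq bitseq) : bool :=
  let S := prune (size S0) Ns S0 in
  if size S <= m then true
  else if r is r'.+1 then
    all (fun N => short_cycles n m r' (count id N) (rcons Ns N) S)
      [seq N <- bitseqs n | ~~ nth false N (size Ns) & d <= count id N]
  else all (fun x => x \in traject (step Ns) (step Ns x) m) S.

Lemma mem_bitseqs (x : bitseq) : x \in bitseqs (size x).
Proof.
elim: x => [|b x IHx] //=; rewrite mem_cat.
by case: b; rewrite map_f ?orbT.
Qed.

Lemma attractor_size_le_return (V : finType) (G : digraph V) c x m :
    attractor G c -> x \in c -> x \in traject (pulse G) (pulse G x) m ->
  size c <= m.
Proof.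
move=> /andP[_ /andP[Gc Uc]] cx /trajectP[i lt_im xi].
rewrite -(order_cycle Gc Uc cx).
(* The orbit of [x] up to its return is a cycle, possibly with repetitions,   *)
(* which bounds the order of [x].                                             *)
suff Gt : fcycle (pulse G) (traject (pulse G) x i.+1).
  have xt : x \in traject (pulse G) x i.+1 by rewrite mem_head.
  by apply: leq_trans (order_le_cycle Gt xt) _; rewrite size_traject.
by rewrite /= [X in rcons _ X]xi -trajectSr fpath_traject.
Qed.

Lemma attractor_size_le_code (V : finType) (G : digraph V) (s : seq V) c S :
    perm_eq s (enum V) -> attractor G c ->
    {subset map (code s) c <= S} ->
  size c <= size S.
Proof.
move=> s_enum /and3P[_ _ Uc] cS; rewrite -(size_map (code s)).
by apply: uniq_leq_size cS; rewrite (map_inj_uniq (code_inj s_enum)).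
Qed.

(** The predecessor of a state on the attractor is itself a candidate, so no
    state of the attractor is ever discarded. *)
Lemma sub_prune (V : finType) (G : digraph V) (s1 s2 : seq V) c k S :
    let s := s1 ++ s2 in
    perm_eq s (enum V) -> attractor G c ->
    {subset map (code s) c <= S} ->
  {subset map (code s) c <= prune k (map (row G s) s1) S}.
Proof.
move=> s s_enum /andP[_ /andP[Gc Uc]].
elim: k S => //= k IHk S cS; case: ifP => // _; apply: IHk => _ /mapP[x cx ->].
rewrite mem_filter cS ?map_f // andbT.
have <- : pulse G (prev c x) = x by apply/eqP; apply: (prev_cycle Gc cx).
apply/mapP; exists (code s (prev c x)); first by rewrite cS // map_f ?mem_prev.
by rewrite step_rows // size_map /code map_cat take_size_cat ?size_map.
Qed.

Lemma short_cycles_sound (V : finType) (G : digraph V) c m s1 s2 d S0 :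
    let s := s1 ++ s2 in
    let deg v := count id (row G s v) in
    perm_eq s (enum V) -> attractor G c ->
    sorted (relpre deg leq) s2 -> all (fun v => d <= deg v) s2 ->
    {subset map (code s) c <= S0} ->
    short_cycles #|V| m (size s2) d (map (row G s) s1) S0 ->
  size c <= m.
Proof.
elim: s2 s1 d S0 => [|v s2 IHs] s1 d S0 s deg s_enum Gc deg_s le_d cS0 /=.
  set S := prune _ _ _.
  have cS : {subset map (code s) c <= S} by apply: sub_prune.
  case: ifP => [le_Sm _ | _ /allP Sm].
    exact: leq_trans (attractor_size_le_code s_enum Gc cS) le_Sm.
  have [x cx] : exists x, x \in c.
    by case/andP: Gc; case: (c) => // x c' _ _; exists x; rewrite mem_head.
  apply: (attractor_size_le_return Gc cx).
  have stepE y : step (map (row G s) s1) (code s y) = code s (pulse G y).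
    by rewrite step_rows // /s cats0.
  have := Sm _ (cS _ (map_f _ cx)); rewrite stepE => /trajectP[i lt_im xi].
  apply/trajectP; exists i => //; apply: (code_inj s_enum); rewrite xi.
  by elim: (i) => //= j ->; rewrite stepE.
set S := prune _ _ _.
have cS : {subset map (code s) c <= S} by apply: sub_prune.
case: ifP => [le_Sm _ | _].
  exact: leq_trans (attractor_size_le_code s_enum Gc cS) le_Sm.
have size_row : size (row G s v) = #|V|.
  by rewrite size_map (perm_size s_enum) -cardE.
(* The vertex [v] has index [size s1] in the listing.                         *)
have noloop : ~~ nth false (row G s v) (size s1).
  rewrite (nth_map v) ?size_cat /= -?addSnnS ?leq_addr //.
  rewrite nth_cat ltnn subnn /=.
  by case: (G) => E loopE /=; move/forallP: loopE; apply.
move=> /allP/(_ (row G s v)); rewrite mem_filter size_map noloop.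
case/andP: le_d => -> _; rewrite -size_row mem_bitseqs => /(_ isT).
have sE : s = rcons s1 v ++ s2 by rewrite cat_rcons.
have deg_tr : transitive (relpre deg leq) by move=> ? ? ?; apply: leq_trans.
rewrite size_row -map_rcons /deg sE; apply: IHs; rewrite -?sE //.
  exact: path_sorted deg_s.
by move: deg_s; rewrite /= (path_sortedE deg_tr) => /andP[].
Qed.

Lemma max_period_le (n m : nat) :
  short_cycles n m n 0 [::] (bitseqs n) -> max_period n <= m.
Proof.
move=> check; apply/max_period_leP => G c Gc.
pose deg v := #|in_neighbours G v|.
pose s := sort (relpre deg leq) (enum 'I_n).
have s_enum : perm_eq s (enum 'I_n) by rewrite perm_sort.
have size_s : size s = n by rewrite size_sort size_enum_ord.
have degE v : count id (row G s v) = deg v.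
  rewrite count_map (count_enum _ s_enum).
  by apply: eq_card => u; rewrite !inE.
apply: (@short_cycles_sound _ G c m [::] s 0 (bitseqs n)) => //=.
- rewrite (eq_sorted (e' := relpre deg leq)) => [|u v /=]; last by rewrite !degE.
  by apply: sort_sorted => u v; apply: leq_total.
- exact/allP.
- move=> _ /mapP[x _ ->].
  by rewrite -[n in bitseqs n]size_s -(size_map x) mem_bitseqs.
by rewrite card_ord size_s.
Qed.

Lemma short_cycles5 : short_cycles 5 9 5 0 [::] (bitseqs 5) = true.
Proof. by vm_cast_no_check (erefl true). Qed.

Theorem proposition5 :
  [/\ #|digraph 'I_1| = 1, #|digraph 'I_2| = 4, #|digraph 'I_3| = 64,
      #|digraph 'I_4| = 4096 & #|digraph 'I_5| = 1048576]
  /\ [/\ max_period 1 = 1, max_period 2 = 1, max_period 3 = 1,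
         max_period 4 = 3 & max_period 5 = 9].
Proof.
split; split; rewrite ?card_digraph5 ?card_digraph ?card_ord //.
- by apply/eqP; rewrite eqn_leq max_period_gt0 max_period_le.
- by apply/eqP; rewrite eqn_leq max_period_gt0 max_period_le.
- by apply/eqP; rewrite eqn_leq max_period_gt0 max_period_le.
- by apply/eqP; rewrite eqn_leq max_period4_ge3 max_period_le //; vm_compute.
by apply/eqP; rewrite eqn_leq max_period5_ge9 (max_period_le short_cycles5).
Qed.
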